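(* Let $0 \le l < n$ be integers, and let $\hat{R}_{n,l}$ be the poset $R_{n,l}$ with a new minimum $\hat{0}$ and a new maximum $\hat{1}$ adjoined. Let $\Lambda_{n,l}$ be the disjoint union of $\{\alpha,\beta\}\times[l+1]\times[n+1]$ and $\binom{[n]}{l+1}$, totally ordered by $\preceq$ as follows: $(\alpha,\ast,\ast)\prec I\prec(\beta,\ast,\ast)$ for every $I\in\binom{[n]}{l+1}$; $(\alpha,i,\ast)\prec(\alpha,j,\ast)$ and $(\beta,i,\ast)\succ(\beta,j,\ast)$ whenever $i<j$ in $[l+1]$; $(\alpha,i,a)\prec(\alpha,i,b)$ and $(\beta,i,a)\prec(\beta,i,b)$ whenever $a<b$ in $[n+1]$; and $\binom{[n]}{l+1}$ is ordered lexicographically, $\{1,\dots,l+1\}\prec\cdots\prec\{n-l,\dots,n\}$ (here $\ast$ denotes an arbitrary entry). Define an edge labeling $\lambda$ of the Hasse diagram of $\hat{R}_{n,l}$ with values in $\Lambda_{n,l}$ by: (i) $\lambda(\hat{0}\lessdot(\{a_1\},\dots,\{a_{l+1}\})) := \{a_1,\dots,a_{l+1}\}$; (ii) if $\hat{0}<x\lessdot y<\hat{1}$ with $x=(A_1,\dots,A_{l+1})$, then $y$ is obtained from $x$ by adding some element $a\notin A_i$ with $\max(A_{i-1})<a<\min(A_{i+1})$ to the $i$th block $A_i$ (with the conventions $\max(\emptyset)$, $\min(\emptyset)$ imposing no condition for $A_0=A_{l+2}=\emptyset$); set $\gamma=\alpha$ if $a<\max(A_i)$ and $\gamma=\beta$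 if $a>\max(A_i)$, and define $\lambda(x\lessdot y):=(\gamma,i,a)$; (iii) $\lambda(x\lessdot\hat{1}):=(\beta,l+1,n+1)$. Then $\lambda$ is an EL-labeling of $\hat{R}_{n,l}$.
   Context: For $n\in\mathbb{N}$, $[n]=\{1,\dots,n\}$ and $\binom{[n]}{k}$ is the set of $k$-element subsets of $[n]$. For $0\le l<n$, $R_{n,l}$ is the poset whose elements are $(l+1)$-tuples $(A_1,\dots,A_{l+1})$ of nonempty subsets of $[n]$ (called blocks) such that $\max(A_i)<\min(A_{i+1})$ for all $i\in[l]$, ordered by componentwise containment: $(A_1,\dots,A_{l+1})\le(B_1,\dots,B_{l+1})$ iff $A_i\subseteq B_i$ for all $i$. (Equivalently, $R_{n,l}$ is the poset of projective sign vectors of length $n$ with exactly $l$ sign changes.) $\hat{R}_{n,l}$ is a finite graded poset. An edge labeling of a finite graded poset $P$ is a function from the cover relations of $P$ to a poset $(\Lambda,\preceq)$; a saturated chain $x_0\lessdot x_1\lessdot\cdots\lessdot x_r$ is increasing if $\lambda(x_0\lessdot x_1)\prec\lambda(x_1\lessdot x_2)\prec\cdots\prec\lambda(x_{r-1}\lessdot x_r)$ (strictly). $\lambda$ is an EL-labeling if for every closed interval $[x,y]$ of $P$: (EL1) there is a unique increasing maximal chain $C_0$ in $[x,y]$; and (EL2) if $x\lessdot z\le y$ with $z\ne x_1$, where $x\lessdot x_1$ is the first edge of $C_0$, then $\lambda(x\lessdot x_1)\prec\lambda(x\lessdot z)$. *)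

(* Defs.v *)
From HB Require Import structures.
From mathcomp Require Import all_boot all_order.
Set Implicit Arguments.
Unset Strict Implicit.
Unset Printing Implicit Defensive.
Import Order.TTheory.

Section ELLabelings.
Context {d d' : Order.disp_t} {P : finPOrderType d} {L : porderType d'}.
Implicit Types (x y z : P) (s : seq P).

Definition covers : rel P :=
  fun x y => (x < y)%O && [forall z : P, ~~ (x < z < y)%O].

(* A chain x0, x1, ..., xr is represented by its head x0 and its tail
   s = [:: x1; ...; xr], as in path.v.  The maximal chains of the closed
   interval [x, y] are the saturated chains of P from x to y. *)
Definition maxchain x y s := path covers x s && (last x s == y).

Definition minimal x := [forall z : P, ~~ (z < x)%O].
Definition maximal x := [forall z : P, ~~ (x < z)%O].

(* All maximal chains of P have the same length. *)
Definition graded :=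
  forall x x' y y' s s', minimal x -> minimal x' -> maximal y -> maximal y' ->
    maxchain x y s -> maxchain x' y' s' -> size s = size s'.

(* An edge labeling is a total function lam : P -> P -> L, of which only the
   values lam x y with covers x y matter. *)
Definition chain_labels (lam : P -> P -> L) x s : seq L := pairmap lam x s.

Definition increasing (lam : P -> P -> L) x s :=
  sorted (fun u v : L => (u < v)%O) (chain_labels lam x s).

Definition EL1 (lam : P -> P -> L) x y :=
  exists! s, maxchain x y s /\ increasing lam x s.

Definition EL2 (lam : P -> P -> L) x y :=
  forall x1 s z, maxchain x y (x1 :: s) -> increasing lam x (x1 :: s) ->
    covers x z -> (z <= y)%O -> z != x1 -> (lam x x1 < lam x z)%O.

Definition EL_labeling (lam : P -> P -> L) :=
  graded /\ forall x y, (x <= y)%O -> EL1 lam x y /\ EL2 lam x y.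

End ELLabelings.

(* The poset P with a new minimum and a new maximum adjoined. *)
Inductive hat (P : Type) : Type := Bot | Mid of P | Top.
Arguments Bot {P}.
Arguments Top {P}.

Section HatFinite.
Variable T : finType.

Definition hat_code (x : hat T) : option (option T) :=
  match x with Bot => None | Mid a => Some (Some a) | Top => Some None end.
Definition hat_decode (o : option (option T)) : hat T :=
  match o with None => Bot | Some (Some a) => Mid a | Some None => Top end.

Lemma hat_codeK : cancel hat_code hat_decode.
Proof. by case. Qed.

HB.instance Definition _ := Finite.copy (hat T) (can_type hat_codeK).
End HatFinite.

Section HatOrder.
Variables (d : Order.disp_t) (P : finPOrderType d).

Definition hat_le (x y : hat P) : bool :=
  match x, y with
  | Bot, _ => true
  | _, Top => true
  | Mid a, Mid b => (a <= b)%O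
  | _, _ => false
  end.

Lemma hat_le_refl : reflexive hat_le.
Proof. by case=> /=. Qed.

Lemma hat_le_anti : antisymmetric hat_le.
Proof. by case=> [|a|] [|b|] //= /le_anti ->. Qed.

Lemma hat_le_trans : transitive hat_le.
Proof. by case=> [|b|] [|a|] [|c|] //=; apply: le_trans. Qed.

HB.instance Definition _ :=
  Order.Le_isPOrder.Build d (hat P) hat_le_refl hat_le_anti hat_le_trans.
End HatOrder.

(* The set [n] is 'I_n and a in [n] has value a - 1 there; likewise for
   [l+1] and [n+1], so that l+1 and n+1 are the elements ord_max. *)

(* Meaningful for nonempty A only. *)
Definition smax n (A : {set 'I_n}) : nat := \max_(a in A) a.
Definition smin n (A : {set 'I_n}) : nat := \big[minn/n]_(a in A) a.

Definition is_R n l (A : {ffun 'I_l.+1 -> {set 'I_n}}) : bool :=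
  [forall i, A i != set0] &&
  [forall i : 'I_l.+1, forall j : 'I_l.+1,
     (j == i.+1 :> nat) ==> (smax (A i) < smin (A j))].

Record R_poset (n l : nat) := RPoset {
  blocks :> {ffun 'I_l.+1 -> {set 'I_n}};
  blocksP : is_R blocks
}.

HB.instance Definition _ n l := [isSub for @blocks n l].
HB.instance Definition _ n l := [Finite of R_poset n l by <:].

Fact R_display : Order.disp_t. Proof. exact: (Order.Disp tt tt). Qed.

Section ROrder.
Variables n l : nat.

Definition R_le (A B : R_poset n l) : bool := [forall i, A i \subset B i].

Lemma R_le_refl : reflexive R_le.
Proof. by move=> A; apply/forallP. Qed.

Lemma R_le_anti : antisymmetric R_le.
Proof.
move=> A B /andP[/forallP AB /forallP BA].
by apply/val_inj/ffunP => i; apply/eqP; rewrite eqEsubset AB BA.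
Qed.

Lemma R_le_trans : transitive R_le.
Proof.
move=> B A C /forallP AB /forallP BC.
by apply/forallP => i; apply: subset_trans (AB i) (BC i).
Qed.

HB.instance Definition _ :=
  Order.Le_isPOrder.Build R_display (R_poset n l)
    R_le_refl R_le_anti R_le_trans.
End ROrder.

Definition ksubset n k := {A : {set 'I_n} | #|A| == k}.

(* The elements of A in increasing order. *)
Definition set_word n (A : {set 'I_n}) : seq nat := [seq val a | a <- enum A].

(* (alpha, i, a), a subset, (beta, i, a) *)
Inductive label (n l : nat) : Type :=
  | LAlpha of 'I_l.+1 & 'I_n.+1
  | LSub of ksubset n l.+1
  | LBeta of 'I_l.+1 & 'I_n.+1.
Arguments LAlpha {n l}.
Arguments LSub {n l}.
Arguments LBeta {n l}.

Fact label_display : Order.disp_t. Proof. exact: (Order.Disp tt tt). Qed.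

Section LabelOrder.
Variables n l : nat.

Let code : Type := 'I_l.+1 * 'I_n.+1 + ksubset n l.+1 + 'I_l.+1 * 'I_n.+1.

Definition label_code (u : label n l) : code :=
  match u with
  | LAlpha i a => inl (inl (i, a))
  | LSub J => inl (inr J)
  | LBeta i a => inr (i, a)
  end.
Definition label_decode (c : code) : label n l :=
  match c with
  | inl (inl p) => LAlpha p.1 p.2
  | inl (inr J) => LSub J
  | inr p => LBeta p.1 p.2
  end.

Lemma label_codeK : cancel label_code label_decode.
Proof. by case. Qed.

HB.instance Definition _ := Finite.copy (label n l) (can_type label_codeK).

Definition label_le (u v : label n l) : bool :=
  match u, v with
  | LAlpha i a, LAlpha j b => (i < j) || ((i == j) && (a <= b))
  | LAlpha _ _, _ => true
  | LSub _, LAlpha _ _ => false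
  | LSub J, LSub K =>
      (set_word (val J) <= set_word (val K) :> seqlexi nat)%O
  | LSub _, LBeta _ _ => true
  | LBeta i a, LBeta j b => (j < i) || ((i == j) && (a <= b))
  | LBeta _ _, _ => false
  end.

Lemma set_word_inj : injective (@set_word n).
Proof.
move=> A B /(inj_map val_inj) eAB.
by apply/setP => a; rewrite -mem_enum eAB mem_enum.
Qed.

Lemma label_le_refl : reflexive label_le.
Proof. by case=> [i a|J|i a] /=; rewrite ?lexx // eqxx leqnn orbT. Qed.

Lemma label_le_anti : antisymmetric label_le.
Proof.
case=> [i a|J|i a] [j b|K|j b] //=.
- rewrite -!val_eqE /=; case: ltngtP => //= /val_inj -> /anti_leq.
  by move/val_inj ->.
- by move/le_anti/set_word_inj/val_inj ->.
- rewrite -!val_eqE /=; case: ltngtP => //= /val_inj -> /anti_leq.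
  by move/val_inj ->.
Qed.

Lemma label_le_trans : transitive label_le.
Proof.
case=> [j b|K|j b] [i a|J|i a] [k c|M|k c] //=.
- case/orP=> [ij|/andP[/eqP-> ab]]; case/orP=> [jk|/andP[/eqP<- bc]].
  + by rewrite (ltn_trans ij jk).
  + by rewrite ij.
  + by rewrite jk.
  + by rewrite eqxx (leq_trans ab bc) orbT.
- exact: le_trans.
- case/orP=> [ij|/andP[/eqP-> ab]]; case/orP=> [jk|/andP[/eqP<- bc]].
  + by rewrite (ltn_trans jk ij).
  + by rewrite ij.
  + by rewrite jk.
  + by rewrite eqxx (leq_trans ab bc) orbT.
Qed.

Lemma label_le_total : total label_le.
Proof.
case=> [i a|J|i a] [j b|K|j b] //=.
- by rewrite -!val_eqE /=; case: ltngtP => //= _; apply: leq_total.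
- exact: le_total.
- by rewrite -!val_eqE /=; case: ltngtP => //= _; apply: leq_total.
Qed.

HB.instance Definition _ :=
  Order.Le_isPOrder.Build label_display (label n l)
    label_le_refl label_le_anti label_le_trans.
HB.instance Definition _ :=
  Order.POrder_isTotal.Build label_display (label n l) label_le_total.
End LabelOrder.

Section Labeling.
Variables n l : nat.

(* Value on pairs that are not cover relations. *)
Definition junk_label : label n l := LAlpha ord0 ord0.

(* The element a of [n], seen in [n+1]. *)
Definition up (a : 'I_n) : 'I_n.+1 := widen_ord (leqnSn n) a.

Definition lam (x y : hat (R_poset n l)) : label n l :=
  match x, y with
  | Bot, Mid B =>
      if insub (\bigcup_i B i) is Some J then LSub J else junk_label
  | Mid A, Mid B =>
      if [pick p : 'I_l.+1 * 'I_n | p.2 \in B p.1 :\: A p.1] is Some (i, a)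
      then if smax (A i) < a then LBeta i (up a) else LAlpha i (up a)
      else junk_label
  | Mid _, Top => LBeta ord_max ord_max
  | _, _ => junk_label
  end.

(* The lemmas below show that junk_label is never used on a cover relation,
   and that lam takes the intended value there. *)

Lemma leq_smax (A : {set 'I_n}) (a : 'I_n) : a \in A -> a <= smax A.
Proof. by move=> aA; apply: (@leq_bigmax_cond _ _ (@nat_of_ord n)). Qed.

Lemma smin_leq (A : {set 'I_n}) (a : 'I_n) : a \in A -> smin A <= a.
Proof.
move=> aA; rewrite /smin; have := mem_index_enum a.
elim: (index_enum _) => // b s IHs; rewrite inE big_cons.
case/predU1P=> [<-|/IHs le_s]; first by rewrite aA geq_minl.
by case: ifP => // _; rewrite geq_min le_s orbT.
Qed.

Lemma smax_ltn_smin (A B : {set 'I_n}) : A != set0 ->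
  (smax A < smin B) = [forall a in A, forall b in B, a < b].
Proof.
case/set0Pn=> a0 a0A; apply/idP/forall_inP => [ltAB a aA|ltAB].
  apply/forall_inP => b bB.
  by apply: leq_ltn_trans (leq_smax aA) _; apply: leq_trans ltAB (smin_leq bB).
have [a aA ->] : exists2 a : 'I_n, a \in A & smax A = a.
  by rewrite /smax (bigop.bigmax_eq_arg a0) //; case: arg_maxnP => // a aA _; exists a.
rewrite /smin; elim/big_ind: _ => [|x y ax ay|b bB]; first exact: ltn_ord.
  by rewrite leq_min ax.
exact: (forall_inP (ltAB a aA)).
Qed.

Lemma R_neq0 (A : R_poset n l) i : A i != set0.
Proof. by case/andP: (blocksP A) => /forallP. Qed.

Lemma is_RP (A : {ffun 'I_l.+1 -> {set 'I_n}}) :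
  reflect ((forall i, A i != set0) /\
           forall (i j : 'I_l.+1) (a b : 'I_n), j = i.+1 :> nat ->
             a \in A i -> b \in A j -> a < b)
          (is_R A).
Proof.
apply: (iffP andP) => [[/forallP A0 /forallP AR]|[A0 AR]]; split=> //.
- move=> i j a b ij aA bA; move/forallP/(_ j): (AR i).
  rewrite ij eqxx /= smax_ltn_smin //.
  by move/forall_inP/(_ a aA)/forall_inP/(_ b bA).
- exact/forallP.
apply/forallP => i; apply/forallP => j; apply/implyP => /eqP ij.
rewrite smax_ltn_smin //; apply/forall_inP => a aA; apply/forall_inP => b bA.
exact: AR ij aA bA.
Qed.

Lemma R_lt (A : R_poset n l) (i j : 'I_l.+1) (a b : 'I_n) :
  i < j -> a \in A i -> b \in A j -> a < b.
Proof.
have [_ AR] := is_RP _ (blocksP A).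
case: j => j; elim: j b => // j IHj b lj ij aA bA.
have lj' : j < l.+1 by apply: ltnW.
have [c cA] := set0Pn _ (R_neq0 A (Ordinal lj')).
have cb : c < b by apply: AR cA bA.
move: ij; rewrite ltnS leq_eqVlt => /orP[/eqP ij|ij].
  by apply: AR aA bA; rewrite /= ij.
exact: ltn_trans (IHj c lj' ij aA cA) cb.
Qed.

Lemma lam_bot (B : R_poset n l) (a : 'I_l.+1 -> 'I_n) :
  (forall i, B i = [set a i]) ->
  exists2 J, lam Bot (Mid B) = LSub J & val J = [set a i | i : 'I_l.+1].
Proof.
move=> Ba; have -> : [set a i | i : 'I_l.+1] = \bigcup_i B i.
  apply/setP => b; apply/imsetP/bigcupP => [[i _ ->]|[i _]].
    by exists i => //; rewrite Ba inE.
  by rewrite Ba inE => /eqP ->; exists i.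
have cardB : #|\bigcup_i B i| == l.+1.
  have -> : \bigcup_i B i = [set a i | i : 'I_l.+1].
    apply/setP => b; apply/bigcupP/imsetP => [[i _]|[i _ ->]].
      by rewrite Ba inE => /eqP ->; exists i.
    by exists i => //; rewrite Ba inE.
  rewrite card_imset ?card_ord // => i j aij; apply/val_inj.
  have aB k : a k \in B k by rewrite Ba inE.
  case: (ltngtP i j) => // ij.
    by have := R_lt ij (aB i) (aB j); rewrite aij ltnn.
  by have := R_lt ij (aB j) (aB i); rewrite aij ltnn.
by exists (exist (fun A : {set 'I_n} => #|A| == l.+1) _ cardB) => //;
  rewrite /lam insubT.
Qed.

Lemma covers_bot (B : R_poset n l) :
  covers Bot (Mid B) -> exists a : 'I_l.+1 -> 'I_n, forall i, B i = [set a i].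
Proof.
case/andP=> _ /forallP minB.
pose a i := xchoose (set0Pn _ (R_neq0 B i)).
have aB i : a i \in B i by apply: xchooseP.
pose A := [ffun i => [set a i]].
have RA : is_R A.
  apply/is_RP; split=> [i|i j b c ij]; rewrite !ffunE.
    by rewrite -card_gt0 cards1.
  rewrite !inE => /eqP -> /eqP ->; apply: R_lt (aB i) (aB j).
  by rewrite ij.
exists a => i; have := minB (Mid (RPoset RA)); rewrite lt_neqAle.
rewrite [(Bot <= _)%O]isT andbT /= lt_neqAle negb_and negbK.
case/orP=> [/eqP[<-]|]; first by rewrite ffunE.
suff -> : (Mid (RPoset RA) <= Mid B)%O by [].
by apply/forallP => j; rewrite ffunE sub1set.
Qed.

(* y is obtained from x by adding a to the ith block. *)
Definition adds (A B : R_poset n l) (i : 'I_l.+1) (a : 'I_n) :=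
  a \notin A i /\ forall j, B j = if j == i then a |: A i else A j.

Lemma covers_mid (A B : R_poset n l) :
  covers (Mid A) (Mid B) -> exists i a, adds A B i a.
Proof.
case/andP; rewrite lt_neqAle => /andP[neAB leAB] /forallP minB.
have {leAB}sAB i : A i \subset B i by move/forallP: leAB.
have [i nsBA] : exists i, ~~ (B i \subset A i).
  apply/existsP; rewrite -negb_forall; apply: contra neAB => /forallP sBA.
  apply/eqP; congr Mid; apply/val_inj/ffunP => i.
  by apply/eqP; rewrite eqEsubset sAB sBA.
have [a aB aA] := subsetPn nsBA; exists i, a; split=> //.
pose C := [ffun j => if j == i then a |: A i else A j].
have sCB j : C j \subset B j.
  by rewrite ffunE; case: eqP => [->|_]; rewrite ?subUset ?sub1set ?aB sAB.
have RC : is_R C.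
  apply/is_RP; split=> [j|j k b c jk bC cC].
    rewrite ffunE; case: (j =P i) => _; last exact: R_neq0.
    by apply/set0Pn; exists a; rewrite !inE eqxx.
  apply: (@R_lt B j k); rewrite ?jk //.
    exact: (subsetP (sCB j)).
  exact: (subsetP (sCB k)).
have ltAC : (Mid A < Mid (RPoset RC))%O.
  rewrite lt_neqAle; apply/andP; split.
    apply/eqP => -[eAC]; move: aA; rewrite eAC /= ffunE eqxx.
    by rewrite !inE eqxx.
  apply/forallP => j; rewrite /= ffunE.
  by case: eqP => [->|_] //; apply: subsetUr.
have := minB (Mid (RPoset RC)); rewrite ltAC /= lt_neqAle negb_and negbK.
case/orP=> [/eqP[<-] j|]; first by rewrite ffunE.
suff -> : (Mid (RPoset RC) <= Mid B)%O by [].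
by apply/forallP.
Qed.

Lemma lam_mid (A B : R_poset n l) i a : adds A B i a ->
  lam (Mid A) (Mid B) =
    if smax (A i) < a then LBeta i (up a) else LAlpha i (up a).
Proof.
case=> aA eB; rewrite /lam; case: pickP => [[j b] /=|/(_ (i, a))].
  rewrite eB; case: eqP => [->|_]; last by rewrite setDv inE.
  by rewrite !inE; case: eqP => [->|_] //=; rewrite andNb.
by rewrite /= eB eqxx !inE eqxx aA.
Qed.

Lemma lam_top (A : R_poset n l) : lam (Mid A) Top = LBeta ord_max ord_max.
Proof. by []. Qed.

Lemma not_covers_bot_top : l < n -> ~~ covers (@Bot (R_poset n l)) Top.
Proof.
move=> ln; pose A : {ffun 'I_l.+1 -> {set 'I_n}} :=
  [ffun i => [set widen_ord ln i]].
have RA : is_R A.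
  apply/is_RP; split=> [i|i j a b ij]; rewrite !ffunE.
    by rewrite -card_gt0 cards1.
  by rewrite !inE => /eqP -> /eqP ->; rewrite /= ij.
by rewrite negb_and; apply/orP; right; rewrite negb_forall;
   apply/existsP; exists (Mid (RPoset RA)).
Qed.

End Labeling.

(* Main.v *)
(* Everything reduces to chains of length two.  Suppose that distinct covers of
   an element carry distinct labels, that labels strictly ascend along
   x < z < w whenever z has the least label among the covers of x below w, and
   that after a cover z of x whose label is not least below y some cover of z
   below y has a label at most that of x < z.  Then, by induction on [x, y],
   the increasing chain must start with the cover of least label, which gives
   both existence and uniqueness and (EL2).

   For lam, the key points are that adding an element to x can only lower the
   labels of the other available additions (a beta may turn into an alpha), and
   that every tuple has a cover in the hatted poset labelled at most
   (beta, l+1, n+1). *)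
Require Import Defs.
From mathcomp Require Import all_boot all_order.

Set Implicit Arguments.
Unset Strict Implicit.
Unset Printing Implicit Defensive.
Import Order.TTheory.

(** * A local criterion for EL-labelings of a finite poset *)

Section Criterion.
Context {d d' : Order.disp_t} {P : finPOrderType d} {L : orderType d'}.
Implicit Types (x y z w : P) (s : seq P).

Lemma covers_lt x y : covers x y -> (x < y)%O.
Proof. by case/andP. Qed.

Lemma covers_sandwich x y z : covers x y -> (x < z)%O -> (z <= y)%O -> z = y.
Proof.
case/andP=> _ /forallP/(_ z); rewrite negb_and => nxzy xz zy.
by apply/eqP; move: nxzy; rewrite xz lt_neqAle zy andbT negbK.
Qed.

Lemma exists_covers x y : (x < y)%O -> exists2 z, covers x z & (z <= y)%O.
Proof.
move=> xy; have Py : [pred z | (x < z)%O && (z <= y)%O] y by rewrite /= xy lexx.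
(* Having the fewest elements strictly below it makes [z] minimal among the elements above [x] and
   at most [y]. *)
case: (arg_minnP (fun z => #|[set w | (w < z)%O]|) Py) => z /andP[xz zy] minz.
exists z => //; rewrite /covers xz; apply/forallP => w.
apply/negP => /andP[xw wz].
have := minz w; rewrite /= xw (le_trans (ltW wz) zy) => /(_ isT).
rewrite leqNgt => /negP; apply; apply: proper_card; apply/properP; split.
  by apply/subsetP => v; rewrite !inE => /lt_trans; apply.
by exists w; rewrite !inE ?ltxx.
Qed.

Lemma path_covers_le x s : path covers x s -> (x <= last x s)%O.
Proof.
elim: s x => //= z s IHs x /andP[/covers_lt xz /IHs].
exact: le_trans (ltW xz).
Qed.

Lemma maxchain_cons x y z s :
  maxchain x y (z :: s) = covers x z && maxchain z y s.
Proof. by rewrite /maxchain /= andbA. Qed.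

Lemma maxchain_le x y s : maxchain x y s -> (x <= y)%O.
Proof. by case/andP=> /path_covers_le xs /eqP <-. Qed.

Lemma maxchain_refl x s : maxchain x x s -> s = [::].
Proof.
case: s => // z s; rewrite maxchain_cons => /andP[/covers_lt xz /maxchain_le].
by move/(lt_le_trans xz); rewrite ltxx.
Qed.

Variable lab : P -> P -> L.

Hypothesis lab_inj : forall x z z',
  covers x z -> covers x z' -> lab x z = lab x z' -> z = z'.
Hypothesis lab_asc : forall x z w, covers x z -> covers z w ->
  (forall z', covers x z' -> (z' <= w)%O -> (lab x z <= lab x z')%O) ->
  (lab x z < lab z w)%O.
Hypothesis lab_desc : forall x y z z', covers x z -> covers x z' ->
  (z < y)%O -> (z' <= y)%O -> (lab x z' < lab x z)%O ->
  exists w, [/\ covers z w, (w <= y)%O & (lab z w <= lab x z)%O].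

Lemma EL_of_local x y : (x <= y)%O -> EL1 lab x y /\ EL2 lab x y.
Proof.
(* Induction on the number of elements strictly above [x], with [y] fixed. *)
have [k] := ubnP #|[set w | (x < w)%O]|; elim: k x => // k IHk x ltk.
rewrite le_eqVlt => /predU1P[<-|xy].
  split=> [|x1 s z /maxchain_refl //].
  exists [::]; split=> [|s [/maxchain_refl //]].
  by rewrite /maxchain /= eqxx.
have [z0 xz0 z0y] := exists_covers xy.
have Pz0 : [pred z | covers x z && (z <= y)%O] z0 by rewrite /= xz0.
case: (arg_minP (lab x) Pz0) => z /andP[xz zy] minz.
have IH v : covers x v -> (v <= y)%O -> EL1 lab v y /\ EL2 lab v y.
  move=> /covers_lt xv; apply: IHk; rewrite -ltnS; apply: leq_trans ltk.
  rewrite ltnS; apply: proper_card; apply/properP; split.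
    by apply/subsetP => w; rewrite !inE; apply: lt_trans.
  by exists v; rewrite !inE ?ltxx.
(* If [x1] differs from [z], then [lab_desc] yields a cover [w] of [x1] labelled at most [lab x x1].
   By (EL2) above [x1], the second label of the chain is at most [lab x1 w], so the chain does not
   increase. *)
have first_min x1 s : maxchain x y (x1 :: s) -> increasing lab x (x1 :: s) ->
    x1 = z.
  rewrite maxchain_cons => /andP[xx1 x1s] inc.
  have x1y := maxchain_le x1s.
  apply/eqP/negPn/negP => x1z.
  have ltz : (lab x z < lab x x1)%O.
    rewrite lt_neqAle minz /= ?xx1 ?andbT //; apply: contraNneq x1z => e.
    by rewrite (lab_inj xx1 xz).
  move: x1y; rewrite le_eqVlt => /predU1P[e|x1y].
    move: x1z; rewrite -(covers_sandwich xx1 (covers_lt xz)) ?e ?eqxx //.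
  have [w [x1w wy lew]] := lab_desc xx1 xz x1y zy ltz.
  case: s inc x1s => [|v s] inc x1s.
    by case/andP: x1s x1y => _ /eqP /= ->; rewrite ltxx.
  have [_ /(_ v s w x1s)] := IH _ xx1 (ltW x1y).
  move: inc; rewrite /increasing /= => /andP[ltv inc] /(_ inc x1w wy).
  have [ewv _|_ /(_ isT) ltvw] := eqVneq w v.
    by move: lew; rewrite leNgt ewv ltv.
  by move: (lt_trans ltv (lt_le_trans ltvw lew)); rewrite ltxx.
have [[s [[zs incs] uniqs]] _] := IH _ xz zy.
split; last first.
  move=> x1 t v xt inct xv vy; rewrite (first_min _ _ xt inct) => vz.
  rewrite lt_neqAle minz /= ?xv ?andbT //; apply: contraNneq vz => e.
  by rewrite (lab_inj xv xz).
exists (z :: s); split=> [|[|v t] [xt inct]].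
- rewrite maxchain_cons xz; split=> //.
  case: s zs incs {uniqs} => // w s; rewrite maxchain_cons => /andP[zw ws] incs.
  rewrite /increasing /= in incs *; rewrite incs andbT.
  (* As [w <= y], minimality of [z] among the covers below [y] restricts to those below [w]. *)
  apply: lab_asc => // z' xz' z'w; apply: minz; rewrite /= xz'.
  exact: le_trans z'w (maxchain_le ws).
- by case/andP: xt xy => _ /eqP /= ->; rewrite ltxx.
- have ev := first_min _ _ xt inct; move: xt inct.
  rewrite ev maxchain_cons => /andP[_ zt] /path_sorted inct.
  by congr (_ :: _); apply: uniqs.
Qed.

End Criterion.

(** * Cover relations of the hatted poset as additions of one element *)

Section RTheory.
Variables n l : nat.
Implicit Types (A B C : R_poset n l) (i j k : 'I_l.+1) (a b c : 'I_n).

Lemma smax_ltP (X : {set 'I_n}) a : X != set0 ->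
  reflect (forall b, b \in X -> b < a) (smax X < a).
Proof.
move=> X0; apply: (iffP idP) => [ltXa b bX|ltXa].
  exact: leq_ltn_trans (leq_smax bX) ltXa.
(* A member of [X] below [a] makes [a] a successor, so the strict bound becomes a weak one on the
   maximum. *)
have [b0 /ltXa] := set0Pn _ X0; case: (nat_of_ord a) ltXa => // m ltXa _.
by rewrite ltnS; apply/bigmax_leqP => b /ltXa.
Qed.

Lemma is_R_sub (X : {ffun 'I_l.+1 -> {set 'I_n}}) B :
  (forall i, X i != set0) -> (forall i, X i \subset B i) -> is_R X.
Proof.
move=> X0 /(_ _)/subsetP XB; apply/is_RP; split=> // i j a b ij aX bX.
by apply: (@R_lt _ _ B i j); rewrite ?ij //; apply: XB.
Qed.

Lemma mid_leP A B : reflect (forall i a, a \in A i -> a \in B i)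
  (Mid A <= Mid B)%O.
Proof.
apply: (iffP forallP) => [AB i|AB i]; first exact/subsetP.
by apply/subsetP/AB.
Qed.

Lemma R_ext A B : (forall i, A i = B i) -> A = B.
Proof. by move=> AB; apply/val_inj/ffunP. Qed.

Lemma adds_in A B i a k c : adds A B i a ->
  (c \in B k) = (k == i) && (c == a) || (c \in A k).
Proof. by case=> _ ->; case: eqP => [->|] //=; rewrite !inE. Qed.

Lemma adds_le A B i a : adds A B i a -> (Mid A <= Mid B)%O.
Proof.
by move=> AB; apply/mid_leP => k c; rewrite (adds_in _ _ AB) orbC => ->.
Qed.

Lemma adds_mem A B i a : adds A B i a -> a \in B i.
Proof. by move=> AB; rewrite (adds_in _ _ AB) !eqxx. Qed.

Lemma adds_uniq A B B' i a : adds A B i a -> adds A B' i a -> B = B'.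
Proof.
by move=> [_ eB] [_ eB']; apply: R_ext => k; rewrite eB eB'.
Qed.

(** Converse of [covers_mid]: a tuple between [A] and [B] is [B] or [A] according to whether its
    block [i] contains [a]. *)
Lemma adds_covers A B i a : adds A B i a -> covers (Mid A) (Mid B).
Proof.
move=> AB; have [aA eB] := AB; have leAB := adds_le AB.
rewrite /covers lt_neqAle leAB andbT; apply/andP; split.
  by apply: contra aA => /eqP[->]; apply: adds_mem AB.
apply/forallP => -[|C|] //=; apply/negP => /andP[AC CB] //.
have [/mid_leP sAC /mid_leP sCB] := (ltW AC, ltW CB).
have [aC|aC] := boolP (a \in C i).
  move: CB; rewrite lt_neqAle => /andP[/eqP[]]; congr Mid.
  apply: R_ext => k; apply/setP => c; apply/idP/idP => [/sCB //|].
  by rewrite (adds_in _ _ AB) => /orP[/andP[/eqP-> /eqP->]|/sAC].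
move: AC; rewrite lt_neqAle => /andP[/eqP[]]; congr Mid.
apply: R_ext => k; apply/setP => c; apply/idP/idP => [/sAC //|cC].
have := sCB _ _ cC; rewrite (adds_in _ _ AB) => /orP[/andP[/eqP ek /eqP ec]|//].
by rewrite -ek -ec cC in aC.
Qed.

(** Both [c] and [a] lie in blocks of [B], which are ordered. With its converse [adds_exists], this
    describes the legal additions by comparison with all blocks, not only the neighbouring ones. *)
Lemma adds_bounds A B i a k c : adds A B i a -> c \in A k ->
  (k < i -> c < a) /\ (i < k -> a < c).
Proof.
move=> AB cA; have cB : c \in B k by rewrite (adds_in _ _ AB) cA orbT.
by split=> lt; [apply: R_lt lt cB _|apply: R_lt lt _ cB]; apply: adds_mem AB.
Qed.

Definition insert A i a : {ffun 'I_l.+1 -> {set 'I_n}} :=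
  [ffun k => if k == i then a |: A i else A k].

Lemma insert_neq0 A i a k : insert A i a k != set0.
Proof.
rewrite ffunE; case: ifP => _; last exact: R_neq0.
by apply/set0Pn; exists a; rewrite setU11.
Qed.

Lemma adds_exists A i a : a \notin A i ->
  (forall k c, c \in A k -> (k < i -> c < a) /\ (i < k -> a < c)) ->
  exists B, adds A B i a.
Proof.
move=> aA bnd; suff RX : is_R (insert A i a).
  by exists (RPoset RX); split=> // k; rewrite /= ffunE.
apply/is_RP; split=> [k|j k b c jk]; first exact: insert_neq0.
rewrite !ffunE; case: eqP => [ji|_]; case: eqP => [ki|_].
- by move: jk; rewrite ji ki => /n_Sn.
- case/setU1P=> [->|bA] cA; last by apply: R_lt bA cA; rewrite jk -ji.
  by apply: (bnd _ _ cA).2; rewrite jk -ji.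
- move=> bA /setU1P[->|cA]; last by apply: R_lt bA cA; rewrite -ki jk.
  by apply: (bnd _ _ bA).1; rewrite -ki jk.
- by move=> bA cA; apply: R_lt bA cA; rewrite jk.
Qed.

(** Below a tuple [C] the order between blocks is inherited from [C], so no bounds on [a] have to be
    checked. *)
Lemma adds_exists_le A C i a :
  (Mid A <= Mid C)%O -> a \in C i -> a \notin A i ->
  exists2 B, adds A B i a & (Mid B <= Mid C)%O.
Proof.
move=> /mid_leP AC aC aA.
have sXC k : insert A i a k \subset C k.
  apply/subsetP => c; rewrite ffunE; case: eqP => [->|_]; last exact: AC.
  by case/setU1P=> [->|/AC].
exists (RPoset (is_R_sub (insert_neq0 A i a) sXC)).
  by split=> // k; rewrite /= ffunE.
by apply/forallP.
Qed.

Lemma adds_le_lub A B C i a :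
  adds A B i a -> (Mid A <= Mid C)%O -> a \in C i -> (Mid B <= Mid C)%O.
Proof.
move=> AB /mid_leP AC aC; apply/mid_leP => k c.
by rewrite (adds_in _ _ AB) => /orP[/andP[/eqP-> /eqP->]|/AC].
Qed.

Lemma singletons_of_covers A : covers Bot (Mid A) -> exists a : 'I_l.+1 -> 'I_n,
  (forall i, A i = [set a i]) /\ {mono a : i j / i < j}.
Proof.
move=> /covers_bot[a eA]; exists a; split=> // i j.
have aA k : a k \in A k by rewrite eA set11.
have [ij|ji|/val_inj->] := ltngtP i j; last by rewrite ltnn.
  exact: R_lt ij (aA i) (aA j).
by apply/negbTE; rewrite -leqNgt ltnW // (R_lt ji (aA j) (aA i)).
Qed.

Lemma covers_of_singletons A (a : 'I_l.+1 -> 'I_n) :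
  (forall i, A i = [set a i]) -> covers Bot (Mid A).
Proof.
move=> eA; apply/andP; split=> //; apply/forallP => -[|B|] //.
apply/negP => /andP[_]; rewrite lt_neqAle => /andP[/eqP neBA /mid_leP BA].
apply: neBA; congr Mid; apply: R_ext => i.
have sBA : B i \subset A i by apply/subsetP/BA.
by move: sBA; rewrite eA subset1 (negbTE (R_neq0 B i)) orbF => /eqP.
Qed.

(** * Rank function and gradedness *)

(** An element [a] missing from all blocks could be added to the last block with an element below
    [a], or to the first block if there is none. Hence the blocks of a coatom partition the ground
    set. *)
Lemma covers_top_size A : covers (Mid A) Top -> \sum_i #|A i| = n.
Proof.
move=> At; have disjA i j : i != j -> [disjoint A i & A j].
  move=> neij; apply/pred0P => a /=; apply/negP => /andP[aA aA'].
  move: neij; rewrite -val_eqE /=; case: ltngtP => // ij _.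
    by have := R_lt ij aA aA'; rewrite ltnn.
  by have := R_lt ij aA' aA; rewrite ltnn.
transitivity (\sum_i \sum_(a in A i) 1).
  by apply: eq_bigr => i _; rewrite sum1_card.
rewrite -(partition_disjoint_bigcup _ (fun=> 1) disjA) sum1_card.
suff -> : \bigcup_i A i = setT by rewrite cardsT card_ord.
apply/setP => a; rewrite inE; apply/negPn/negP => naU.
have naA k : a \notin A k.
  by apply: contra naU => aA; apply/bigcupP; exists k.
suff [i bnd] : exists i,
    forall k c, c \in A k -> (k < i -> c < a) /\ (i < k -> a < c).
  have [B AB] := adds_exists (naA i) bnd.
  case/andP: At => _ /forallP/(_ (Mid B)).
  by rewrite (covers_lt (adds_covers AB)).
have gt_of k c : c \in A k -> ~~ (c < a) -> a < c.
  move=> cA; rewrite -leqNgt leq_eqVlt => /predU1P[/val_inj eac|//].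
  by rewrite -eac (negbTE (naA k)) in cA.
have [/existsP[i0 Pi0]|none] := boolP [exists i, [exists b in A i, b < a]].
  have [i /exists_inP[b bA ba] maxi] :=
    @arg_maxnP _ i0 (fun i => [exists b in A i, b < a]) val Pi0.
  exists i => k c cA; split=> lt; first exact: ltn_trans (R_lt lt cA bA) ba.
  apply: gt_of (cA) _; apply: contraL lt => ca; rewrite -leqNgt.
  by apply: maxi; apply/exists_inP; exists c.
exists ord0 => k c cA; split=> // _; apply: gt_of (cA) _.
apply: contra none => ca; apply/existsP; exists k.
by apply/exists_inP; exists c.
Qed.

(** The rank shifted by [l]: atoms consist of [l+1] singletons, so [Bot] gets [l], and coatoms use
    all [n] elements, so [Top] gets [n+1]. *)
Definition hat_rank (x : hat (R_poset n l)) : nat :=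
  match x with Bot => l | Mid A => \sum_i #|A i| | Top => n.+1 end.

Lemma hat_rank_covers x y : l < n -> covers x y -> hat_rank y = (hat_rank x).+1.
Proof.
move=> ln; case: x y => [|A|] [|B|] xy //=; try by case/andP: xy.
- have [a [eB _]] := singletons_of_covers xy.
  rewrite (eq_bigr (fun=> 1)) => [|i _]; last by rewrite eB cards1.
  by rewrite sum1_card card_ord.
- by move: (not_covers_bot_top ln); rewrite xy.
- have [i [a [aA eB]]] := covers_mid xy.
  rewrite (bigD1 i) // [in RHS](bigD1 i) //= eB eqxx cardsU1 aA; congr _.+1.
  by congr (_ + _); apply: eq_bigr => k /negbTE ki; rewrite eB ki.
- by rewrite (covers_top_size xy).
Qed.

Lemma hat_rank_maxchain x y s : l < n ->
  maxchain x y s -> hat_rank y = hat_rank x + size s.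
Proof.
move=> ln; elim: s x => [|z s IHs] x.
  by case/andP=> _ /eqP /= ->; rewrite addn0.
rewrite maxchain_cons => /andP[xz /IHs ->].
by rewrite (hat_rank_covers ln xz) addSnnS.
Qed.

Lemma hat_graded : l < n -> @graded _ (hat (R_poset n l)).
Proof.
move=> ln x x' y y' s s'.
have minE z : minimal z -> z = Bot :> hat (R_poset n l).
  by move=> /forallP/(_ Bot); case: z.
have maxE z : maximal z -> z = Top :> hat (R_poset n l).
  by move=> /forallP/(_ Top); case: z.
move=> /minE -> /minE -> /maxE -> /maxE -> /(hat_rank_maxchain ln) e.
by move=> /(hat_rank_maxchain ln); rewrite e => /addnI.
Qed.


(** * Injectivity and comparison of labels *)

(** Equal lengths exclude proper prefixes, so the first difference decides. *)
Lemma seqlexi_lt_nth (s t : seq nat) : size s = size t ->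
  (s < t :> seqlexi nat)%O ->
  exists2 m, m < size s &
    nth 0 s m < nth 0 t m /\ forall q, q < m -> nth 0 s q = nth 0 t q.
Proof.
elim: s t => [|x s IHs] [|y t] //= [est].
rewrite ltxi_cons !leEnat; case: ltngtP => //= [ltxy _|-> lt_st].
  by exists 0.
have [m ms [ltm eqm]] := IHs _ est lt_st.
by exists m.+1 => //; split=> // -[|q] //= /eqm.
Qed.

(** Since the blocks are ordered, both words are strictly increasing with the same entries.
    Lexicographic comparison of atom labels thus becomes comparison block by block. *)
Lemma lam_bot_word A (a : 'I_l.+1 -> 'I_n) : (forall i, A i = [set a i]) ->
  exists2 J, lam Bot (Mid A) = LSub J &
  set_word (val J) = [seq val (a i) | i <- enum 'I_l.+1].
Proof.
move=> eA; have [J -> eJ] := lam_bot eA; exists J => //; rewrite eJ.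
apply: (irr_sorted_eq ltn_trans ltnn).
- rewrite /set_word sorted_map /= {1}/(enum _) -enumT.
  apply: sorted_filter => [x y z|]; first exact: ltn_trans.
  by rewrite -sorted_map val_enum_ord iota_ltn_sorted.
- rewrite sorted_map; have := iota_ltn_sorted 0 l.+1.
  rewrite -val_enum_ord sorted_map; apply: sub_sorted => i j ij /=.
  by apply: (@R_lt _ _ A i j) ij _ _; rewrite eA set11.
move=> x; apply/mapP/mapP => [[c]|[i _ ->]].
  by rewrite mem_enum => /imsetP[i _ ->] ->; exists i; rewrite ?mem_enum.
by exists (a i); rewrite // mem_enum imset_f.
Qed.

Lemma lt_LSub (J K : ksubset n l.+1) : (LSub J < LSub K)%O =
  (set_word (val J) < set_word (val K) :> seqlexi nat)%O.
Proof. by rewrite !ltNge. Qed.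

Lemma le_LBeta i j (a b : 'I_n.+1) :
  (LBeta i a <= LBeta j b)%O = (j < i) || (i == j) && (a <= b).
Proof. by []. Qed.

Lemma le_LAlpha i j (a b : 'I_n.+1) :
  (LAlpha i a <= LAlpha j b)%O = (i < j) || (i == j) && (a <= b).
Proof. by []. Qed.

Lemma lam_bot_lt A B (a b : 'I_l.+1 -> 'I_n) :
  (forall i, A i = [set a i]) -> (forall i, B i = [set b i]) ->
  (lam Bot (Mid A) < lam Bot (Mid B))%O ->
  exists i, a i < b i /\ forall j, j < i -> a j = b j.
Proof.
move=> eA eB; have [J -> wJ] := lam_bot_word eA.
have [K -> wK] := lam_bot_word eB.
have nthE (f : 'I_l.+1 -> 'I_n) (i : 'I_l.+1) :
    nth 0 [seq val (f i) | i <- enum 'I_l.+1] i = f i.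
  by rewrite (nth_map i) ?nth_ord_enum // size_enum_ord.
rewrite lt_LSub wJ wK.
case/seqlexi_lt_nth; first by rewrite !size_map.
move=> m; rewrite size_map size_enum_ord => ml [ltm eqm].
exists (Ordinal ml); split=> [|j jm].
  by have := ltm; rewrite -[m]/(val (Ordinal ml)) !nthE.
by apply: val_inj; have := eqm _ jm; rewrite !nthE.
Qed.

Lemma lam_bot_inj A B : covers Bot (Mid A) -> covers Bot (Mid B) ->
  lam Bot (Mid A) = lam Bot (Mid B) -> A = B.
Proof.
move=> /singletons_of_covers[a [eA _]] /singletons_of_covers[b [eB _]].
have [J -> wJ] := lam_bot_word eA; have [K -> wK] := lam_bot_word eB.
case=> eJK; apply: R_ext => i; rewrite eA eB; congr [set _].
have : [seq val (a i) | i <- enum 'I_l.+1] =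
       [seq val (b i) | i <- enum 'I_l.+1].
  by rewrite -wJ eJK.
by move/eq_in_map/(_ i); rewrite mem_enum => /(_ isT)/val_inj.
Qed.

Lemma lam_adds_inj A B C i j a b : adds A B i a -> adds A C j b ->
  lam (Mid A) (Mid B) = lam (Mid A) (Mid C) -> (i, a) = (j, b).
Proof.
move=> AB ACb; rewrite (lam_mid AB) (lam_mid ACb).
by case: ifP => _; case: ifP => // _ [-> /ord_inj ->].
Qed.

Lemma covers_mid_top A B :
  covers (Mid A) (Mid B) -> covers (Mid A) Top -> False.
Proof.
move=> AB At; have leBt : (Mid B <= Top)%O by [].
by have := covers_sandwich At (covers_lt AB) leBt.
Qed.

Lemma lam_inj (x z z' : hat (R_poset n l)) : l < n ->
  covers x z -> covers x z' -> lam x z = lam x z' -> z = z'.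
Proof.
move=> ln; case: x z z' => [|A|] [|B|] [|C|] // xB xC.
- by move/(lam_bot_inj xB xC) ->.
- by rewrite (negbTE (not_covers_bot_top ln)) in xC.
- by rewrite (negbTE (not_covers_bot_top ln)) in xB.
- have [i [a AB]] := covers_mid xB; have [j [b ACb]] := covers_mid xC.
  move=> /(lam_adds_inj AB ACb)[eij eab]; subst j b.
  by rewrite (adds_uniq AB ACb).
- by case: (covers_mid_top xB xC).
- by case: (covers_mid_top xC xB).
Qed.

(** Enlarging a block can only raise its maximum, which may turn beta into alpha but never alpha
    into beta. *)
Lemma lam_adds_mono A A' B B' i a : adds A B i a -> adds A' B' i a ->
  (Mid A <= Mid A')%O -> (lam (Mid A') (Mid B') <= lam (Mid A) (Mid B))%O.
Proof.
move=> AB AB' /mid_leP AA'; rewrite (lam_mid AB) (lam_mid AB').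
have [/smax_ltP lt'|_] := boolP (smax (A' i) < a).
  have /smax_ltP -> // : forall b, b \in A i -> b < a.
    by move=> b /AA'; apply: lt'; apply: R_neq0.
  exact: R_neq0.
by case: ifP => _ //; rewrite le_LBeta eqxx leqnn orbT.
Qed.

(* A beta-addition of a to a block other than the last can be replaced by the
   alpha-addition of a to the next block. *)
Lemma lam_le_beta_max A : exists2 w, covers (Mid A) w &
  (lam (Mid A) w <= LBeta ord_max ord_max)%O.
Proof.
have [At|] := boolP (covers (Mid A) Top); first by exists Top.
case/nandP=> // /forallPn[[|C|]] // /negPn/andP[ACb _] //.
have [w Aw wC] := exists_covers ACb; case: w Aw wC => // B AB _.
have [i [a ABia]] := covers_mid AB.
have [ltmax|gemax] := boolP (smax (A i) < a); last first.
  by exists (Mid B) => //; rewrite (lam_mid ABia) (negbTE gemax).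
have [il|] := ltnP i l; last first.
  (* Here [i] is the last block, and every element added to it is smaller than the extra value
     [ord_max] of ['I_n.+1]. *)
  rewrite leq_eqVlt ltnNge -ltnS ltn_ord orbF => /eqP li.
  exists (Mid B) => //; rewrite (lam_mid ABia) ltmax le_LBeta.
  have -> : i = ord_max by apply: ord_inj.
  by rewrite eqxx (ltnW (ltn_ord a)) orbT.
have il1 : i.+1 < l.+1 by [].
pose j := Ordinal il1.
have aj c : c \in A j -> a < c by move=> /(adds_bounds ABia)[_]; apply.
have aAj : a \notin A j by apply/negP => /aj; rewrite ltnn.
have [k c cA|B' AB'] := adds_exists aAj.
  split=> lt; last by apply: (adds_bounds ABia cA).2; apply: ltn_trans lt.
  move: lt; rewrite ltnS leq_eqVlt => /predU1P[/val_inj ki|ki].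
    by move/smax_ltP: ltmax; apply; rewrite -?ki ?R_neq0.
  exact: (adds_bounds ABia cA).1.
exists (Mid B'); first exact: adds_covers AB'.
(* All of block [j] lies above [a], so the new label is an alpha, below every beta. *)
rewrite (lam_mid AB') ifN //; have [c cA] := set0Pn _ (R_neq0 A j).
by rewrite -leqNgt (leq_trans (ltnW (aj _ cA))) ?leq_smax.
Qed.

(** * The ascent and descent conditions for [lam] *)

Lemma lam_asc (x z w : hat (R_poset n l)) : l < n ->
  covers x z -> covers z w ->
  (forall z', covers x z' -> (z' <= w)%O -> (lam x z <= lam x z')%O) ->
  (lam x z < lam z w)%O.
Proof.
move=> ln; case: x z w => [|A|] [|B|] [|C|] // xz zw minz;
  try by case/andP: xz; try by case/andP: zw.
- have [b [eB monob]] := singletons_of_covers xz.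
  have [J eJ _] := lam_bot eB.
  have [i [c BC]] := covers_mid zw.
  rewrite eJ (lam_mid BC); case: ifP => // /negbT; rewrite eB /smax big_set1.
  rewrite -leqNgt => cb; exfalso.
  have {}cb : c < b i.
    have := BC.1; rewrite eB inE -val_eqE /=.
    by case: ltngtP cb.
  (* An alpha-addition of c to {b i} would give the lexicographically smaller
     atom with b i replaced by c. *)
  pose a k := if k == i then c else b k.
  have sAC k : [ffun k => [set a k]] k \subset C k.
    rewrite ffunE sub1set (adds_in _ _ BC) /a eB inE.
    by case: eqP => // _; rewrite eqxx.
  have A0 k : [ffun k => [set a k]] k != set0 :> {set 'I_n}.
    by rewrite ffunE; apply/set0Pn; exists (a k); rewrite inE.
  pose A := RPoset (is_R_sub A0 sAC).
  have eA k : A k = [set a k] by rewrite /= ffunE.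
  have xA := covers_of_singletons eA.
  have leAC : (Mid A <= Mid C)%O by apply/forallP.
  have := minz _ xA leAC; rewrite le_eqVlt.
  case/predU1P=> [e|/(lam_bot_lt eB eA)[k []]].
    have := eA i; rewrite -(lam_bot_inj xz xA e) eB => /set1_inj.
    by rewrite /a eqxx => e'; rewrite e' ltnn in cb.
  by rewrite /a; case: eqP => [->|_]; rewrite ?ltnn // ltnNge ltnW.
- by have [b [/lam_bot[J -> _] _]] := singletons_of_covers xz.
- have [i [a AB]] := covers_mid xz; have [j [b BC]] := covers_mid zw.
  have bA : b \notin A j.
    by apply: contra BC.1 => bA; rewrite (adds_in _ _ AB) bA orbT.
  have leAC := le_trans (adds_le AB) (adds_le BC).
  (* Interchange of the two additions: [B'] is [A] with [b] added first, and minimality of [z] is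
     tested against it. *)
  have [B' AB' B'C] := adds_exists_le leAC (adds_mem BC) bA.
  have {minz} := minz _ (adds_covers AB') B'C.
  rewrite le_eqVlt => /predU1P[/(lam_adds_inj AB AB')[ei ea]|].
    by have := BC.1; rewrite -ei -ea (adds_mem AB).
  rewrite (lam_mid AB') (lam_mid BC).
  have [ltBb|leBb] := boolP (smax (B j) < b).
    suff -> : smax (A j) < b by [].
    apply/smax_ltP => [|c cA]; first exact: R_neq0.
    by move/smax_ltP: ltBb; apply; rewrite ?R_neq0 // (adds_in _ _ AB) cA orbT.
  (* The label of [b] drops from beta to alpha only if [a] was placed above [b] in the same block.
     Then [a] and [b] are both beta-additions to that block of [A], and [b] has the smaller label,
     against minimality. *)
  case: ifP => // ltAb; rewrite (lam_mid AB).
  suff [eij ltba] : i = j /\ b < a.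
    subst j; rewrite ifT ?(ltn_trans ltAb) //.
    by rewrite ltNge le_LBeta ltnn eqxx ltnW.
  have /existsP[c /andP[cB bc]] : [exists c, (c \in B j) && (b <= c)].
    apply: contraNT leBb => /existsPn noc.
    apply/smax_ltP => [|c cB]; first exact: R_neq0.
    by have := noc c; rewrite cB -ltnNge.
  have := cB; rewrite (adds_in _ _ AB).
  case/orP=> [/andP[/eqP ej /eqP ec]|cA]; last first.
    by move: ltAb; rewrite ltnNge (leq_trans bc) ?leq_smax.
  subst j c; split=> //; rewrite ltn_neqAle bc andbT.
  by apply: contraNneq BC.1 => /val_inj ->.
- have [w Aw lew] := lam_le_beta_max A.
  have wt : (w <= Top)%O by case: w {Aw lew}.
  rewrite lt_neqAle (le_trans (minz _ Aw wt) lew) andbT.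
  have [i [a AB]] := covers_mid xz; rewrite (lam_mid AB) lam_top.
  (* Strictness: [up a] has value less than [n], the value of [ord_max]. *)
  case: ifP => // _; apply/eqP => -[_ ea].
  by have := ltn_ord a; rewrite ea ltnn.
Qed.

(** When [x] is a tuple, the natural [w] performs on [z] the addition that leads from [x] to [z'];
    by [lam_adds_mono] its label does not exceed that of [x < z']. *)
Lemma lam_desc (x y z z' : hat (R_poset n l)) : l < n ->
  covers x z -> covers x z' -> (z < y)%O -> (z' <= y)%O ->
  (lam x z' < lam x z)%O ->
  exists w, [/\ covers z w, (w <= y)%O & (lam z w <= lam x z)%O].
Proof.
move=> ln; case: x z z' => [|A|] [|B|] [|C|] // xz xz' zy z'y ltz;
  try by case/andP: xz; try by case/andP: xz'.
- have [b [eB monob]] := singletons_of_covers xz.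
  have [c [eC monoc]] := singletons_of_covers xz'.
  have [i [lti eqi]] := lam_bot_lt eC eB ltz.
  (* At the first difference [i], the element [c i] lies below [b i] and above the earlier
     [b k = c k]. It can be added to block [i] of [B] by alpha, and alpha-labels are below all
     subset labels. *)
  have cB : c i \notin B i by rewrite eB inE -val_eqE /= ltn_eqF.
  have [k d|W BW] := adds_exists cB.
    rewrite eB inE => /eqP ->; split=> ki; first by rewrite -eqi // monoc.
    by apply: ltn_trans lti _; rewrite monob.
  exists (Mid W); split; first exact: adds_covers BW.
    case: y zy z'y => // Y /ltW BY /mid_leP CY.
    by apply: adds_le_lub BW BY _; apply: CY; rewrite eC set11.
  have [J -> _] := lam_bot eB; rewrite (lam_mid BW) ifN //.
  by rewrite eB /smax big_set1 -leqNgt ltnW.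
- by rewrite (negbTE (not_covers_bot_top ln)) in xz'.
- by rewrite (negbTE (not_covers_bot_top ln)) in xz.
- have [i [a AB]] := covers_mid xz; have [j [b ACb]] := covers_mid xz'.
  have bB : b \notin B j.
    rewrite (adds_in _ _ AB) negb_or ACb.1 andbT; apply: contraTN ltz.
    by case/andP=> /eqP ej /eqP eb; subst j b; rewrite (adds_uniq AB ACb) ltxx.
  suff [[w [zw wy lew]]|[W BW WY]] :
      (exists w, [/\ covers (Mid B) w, (w <= y)%O
                   & (lam (Mid B) w <= lam (Mid A) (Mid B))%O])
      \/ (exists2 W, adds B W j b & (Mid W <= y)%O).
  + by exists w.
  + exists (Mid W); split; [exact: adds_covers BW|exact: WY|].
    exact: le_trans (lam_adds_mono ACb BW (adds_le AB)) (ltW ltz).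
  (* Below a tuple Y the two additions always commute.  Below 1^ they may clash,
     but then B adds to a block i < l by beta, and lam_le_beta_max applies. *)
  case: y zy z'y => // [Y|] zy z'y.
    right; apply: (adds_exists_le (ltW zy) _ bB).
    by move/mid_leP: z'y; apply; apply: adds_mem ACb.
  have [ltmax|lemax] := ltP (lam (Mid A) (Mid B)) (LBeta ord_max ord_max);
    last first.
    left; have [w Bw lew] := lam_le_beta_max B.
    exists w; split; [exact: Bw|by case: w {Bw lew}|exact: le_trans lew lemax].
  right; suff [W BW] : exists W, adds B W j b by exists W.
  apply: adds_exists bB _ => k c.
  rewrite (adds_in _ _ AB) => /orP[/andP[/eqP-> /eqP->]|]; last first.
    exact: adds_bounds ACb.
  (* An alpha-addition puts [b] at most at the maximum of block [j], while [a] exceeds that whole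
     block when [j < i]. *)
  have ltba : smax (A j) >= b -> j < i -> b < a.
    move=> leb ji; rewrite ltnNge; apply/negP => ab.
    suff : smax (A j) < b by rewrite ltnNge leb.
    apply/smax_ltP => [|d dA]; first exact: R_neq0.
    by apply: leq_trans ab; apply: (adds_bounds AB dA).1.
  (* Only the position of [b] relative to [a] is left. If [a] is a beta-addition, [ltmax] makes [i]
     the last block and rules out [i < j]; if both are alpha-additions, [ltz] rules it out. *)
  move: ltz ltmax; rewrite (lam_mid AB) (lam_mid ACb) !ltNge.
  have [lta|lea] := boolP (smax (A i) < a);
    have [ltb|leb] := boolP (smax (A j) < b).
  + rewrite !le_LBeta !negb_or => /andP[ji _] /andP[il _].
    split=> [ij|]; last by rewrite (negbTE ji).
    by case/negP: il; apply: leq_trans ij _; rewrite -ltnS.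
  + rewrite !le_LBeta !negb_or => _ /andP[il _].
    split=> [ij|]; last by apply: ltba; rewrite leqNgt.
    by case/negP: il; apply: leq_trans ij _; rewrite -ltnS.
  + by [].
  + rewrite le_LAlpha !negb_or => /andP[ij _] _.
    by split; [rewrite (negbTE ij)|apply: ltba; rewrite leqNgt].
- by case: (covers_mid_top xz xz').
- by case: (covers_mid_top xz' xz).
- by rewrite ltxx in ltz.
Qed.

End RTheory.

Theorem theorem2p9 (n l : nat) (hln : l < n) : EL_labeling (@lam n l).
Proof.
split=> [|x y]; first exact: hat_graded.
apply: EL_of_local => [x' z z'|x' z w|x' y' z z'].
- exact: lam_inj.
- exact: lam_asc.
- exact: lam_desc.
Qed.
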